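(* Let $$G_{44}=\langle x,y,z \mid x^2=y^8=z^2=1,\ x^{-1}yx=y^5,\ z^{-1}yz=y^{-1},\ xz=zx\rangle,$$ $$G_{45}=\langle x,y,z \mid x^2=y^8=1,\ z^2=y^4,\ x^{-1}yx=y^5,\ z^{-1}yz=y^{-1},\ xz=zx\rangle.$$ For each of the groups $G_{44}$ and $G_{45}$, there exist class preserving automorphisms which are not inner.
   Context: An automorphism $\alpha$ of a finite group $G$ is called class preserving if, for every $g\in G$, the element $\alpha(g)$ is conjugate to $g$ in $G$. The groups $G_{44}$ and $G_{45}$ are two non-isomorphic groups of order $32$. *)

(* Defs.v *)
From HB Require Import structures.
From mathcomp Require Import all_boot all_algebra all_fingroup.

Set Implicit Arguments.
Unset Strict Implicit.
Unset Printing Implicit Defensive.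
Import GRing.Theory.
Local Open Scope group_scope.

(* In MathComp [x ^ y] is [y^-1 * (x * y)]. *)
Definition is_G44 (gT : finGroupType) (G : {group gT}) : Prop :=
  G \isog Grp (x : y : z :
    x ^+ 2, y ^+ 8, z ^+ 2, y ^ x = y ^+ 5, y ^ z = y^-1, x * z = z * x).

Definition is_G45 (gT : finGroupType) (G : {group gT}) : Prop :=
  G \isog Grp (x : y : z :
    x ^+ 2, y ^+ 8, z ^+ 2 = y ^+ 4, y ^ x = y ^+ 5, y ^ z = y^-1,
    x * z = z * x).

Definition class_preserving (gT : finGroupType) (G : {group gT})
  (alpha : {perm gT}) : Prop := {in G, forall g, alpha g \in g ^: G}.

(* [conj_aut G h] is conjugation by [h] on [G]. *)
Definition inner (gT : finGroupType) (G : {group gT})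
  (alpha : {perm gT}) : Prop := exists2 h, h \in G & alpha = conj_aut G h.

(* [G \isog Grp p] says that [G] is the largest finite factor of the group
   presented by [p]; it is that group as soon as the latter is finite. Both
   presentations above do define finite groups: their relations bring every
   word to a normal form [y ^+ j * x ^+ i * z ^+ k] with [j < 8], [i < 2] and
   [k < 2]. The rest of this file shows that these 32 normal forms are
   distinct, hence that [is_G44] and [is_G45] are satisfiable, by multiplying
   the triples [(j, i, k)]; [c] tells whether [z ^+ 2] is [y ^+ 4] or [1]. *)
Section Model.

Local Open Scope ring_scope.

Definition model (c : bool) : Type := ('Z_8 * bool * bool)%type.

HB.instance Definition _ c := Finite.on (model c).

Definition model_act (i k : bool) : 'Z_8 := (5 ^+ i * (-1) ^+ k).

Definition model_carry (c k k' : bool) : 'Z_8 := (4 *+ [&& c, k & k']).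

Definition model_mul c (a b : model c) : model c :=
  let: (j, i, k) := a in let: (j', i', k') := b in
  (j + model_act i k * j' + model_carry c k k', i (+) i', k (+) k').

Definition model_inv c (a : model c) : model c :=
  let: (j, i, k) := a in
  (- (model_act i k * (j + model_carry c k k)), i, k).

Lemma model_mulA c : associative (@model_mul c).
Proof.
move=> [[j1 i1] k1] [[j2 i2] k2] [[j3 i3] k3] /=; rewrite !addbA.
congr (_, _, _).
have -> : model_act (i1 (+) i2) (k1 (+) k2) = model_act i1 k1 * model_act i2 k2.
  by case: i1 i2 k1 k2 => [] [] [] []; apply/val_inj.
rewrite !mulrDr !mulrA -!addrA; congr (_ + (_ + _)).
rewrite [RHS]addrCA; congr (_ + _).
by case: c i1 k1 k2 k3 => [] [] [] [] []; apply/val_inj.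
Qed.

Lemma model_mul1 c : left_id ((0, false, false) : model c) (@model_mul c).
Proof.
by move=> [[j i] k]; rewrite /= /model_act /model_carry andbF !mul1r add0r addr0.
Qed.

Lemma model_mulV c :
  left_inverse ((0, false, false) : model c) (@model_inv c) (@model_mul c).
Proof.
move=> [[j i] k] /=; rewrite !addbb; congr (_, _, _).
rewrite mulrDr opprD [X in X + _]addrAC addNr add0r.
by case: c i k => [] [] []; apply/val_inj.
Qed.

HB.instance Definition _ c :=
  Finite_isGroup.Build (model c) (@model_mulA c) (@model_mul1 c)
    (@model_mulV c).

End Model.

Definition model_y c : model c := (1%R, false, false).
Definition model_x c : model c := (0%R, true, false).
Definition model_z c : model c := (0%R, false, true).

Lemma model_yX c n : model_y c ^+ n = (n%:R%R, false, false).
Proof.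
elim: n => [|n IHn]; first by [].
rewrite expgS IHn mulrS; congr (_, _, _).
by rewrite /= /model_act /model_carry /= andbF !mul1r [LHS]addr0.
Qed.

Lemma model_normal c (a : model c) :
  a = model_y c ^+ a.1.1 * model_x c ^+ a.1.2 * model_z c ^+ a.2.
Proof.
case: a => [[j i] k] /=; rewrite model_yX natr_Zp.
by case: i k => [] [];
  rewrite ?mulg1 /mulg /= /model_act /model_carry /= ?andbF ?mulr0 ?addr0.
Qed.

Lemma model_gen c :
  <[model_x c]> <*> <[model_y c]> <*> <[model_z c]> = [set: model c].
Proof.
apply/eqP; rewrite eqEsubset subsetT; apply/subsetP=> a _.
rewrite (model_normal a) !groupM // groupX //.
- by rewrite mem_gen // inE mem_gen // inE cycle_id orbT.
- by rewrite mem_gen // inE mem_gen // inE cycle_id.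
by rewrite mem_gen // inE cycle_id orbT.
Qed.

Lemma model_rel c (x := model_x c) (y := model_y c) (z := model_z c) :
  (x ^+ 2, y ^+ 8, z ^+ 2, y ^ x, y ^ z, x * z)
    = (1, 1, y ^+ (4 * c), y ^+ 5, y^-1, z * x).
Proof.
rewrite {}/x {}/y {}/z !model_yX.
by case: c; congr (_, _, _, _, _, _); congr (_, _, _); apply/val_inj.
Qed.

Lemma model_isoGrp c : [set: model c] \isog Grp (x : y : z :
  x ^+ 2, y ^+ 8, z ^+ 2 = y ^+ (4 * c), y ^ x = y ^+ 5, y ^ z = y^-1,
  x * z = z * x).
Proof.
apply: intro_isoGrp => [|rT H].
  have := model_gen c; have := model_rel c.
  move: (model_x c) (model_y c) (model_z c) => x y z [x2 y8 zz yx yz xz] genG.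
  by apply/existsP; exists (x, y, z); rewrite /= genG x2 y8 zz yx yz xz.
case/existsP=> -[[x y] z] /= /eqP[defH x2 y8 zz yx yz xz].
have yD (a b : 'Z_8) : y ^+ (a + b)%R = y ^+ a * y ^+ b.
  by rewrite -expgD /= expg_mod.
have yM (a b : 'Z_8) : y ^+ (a * b)%R = (y ^+ a) ^+ b.
  by rewrite -expgM /= expg_mod.
have yN (a : 'Z_8) : y ^+ (- a)%R = y ^- a.
  by apply: (mulgI (y ^+ a)); rewrite -yD subrr mulgV.
have act1 u (e b : 'Z_8) :
    y ^ u^-1 = y ^+ e -> u * y ^+ b = y ^+ (e * b)%R * u.
  by move=> yu; rewrite yM -yu -conjXg conjgE invgK mulgA mulgKV.
have xV : x^-1 = x by rewrite -[LHS]mul1g -x2 expgS expg1 mulgK.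
have actX (i : bool) (b : 'Z_8) :
    x ^+ i * y ^+ b = y ^+ (5 ^+ i * b)%R * x ^+ i.
  by case: i; [apply: act1; rewrite xV yx | rewrite mul1r mul1g mulg1].
have actZ (k : bool) (b : 'Z_8) :
    z ^+ k * y ^+ b = y ^+ ((-1) ^+ k * b)%R * z ^+ k.
  case: k; last by rewrite mul1r mul1g mulg1.
  by apply: act1; rewrite expr1 yN -[RHS](conjgK z) conjVg yz invgK.
have xX (i i' : bool) : x ^+ i * x ^+ i' = x ^+ (i (+) i').
  by case: i i' => [] [] //; rewrite ?mulg1 ?mul1g // -expgS x2.
have zX (k k' : bool) :
    z ^+ k * z ^+ k' = y ^+ model_carry c k k' * z ^+ (k (+) k').
  by rewrite /model_carry; case: k k' c zz => [] [] [] zz;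
    rewrite ?mul1g ?mulg1 // -expgS zz.
have carryX (i k k' : bool) :
    x ^+ i * y ^+ model_carry c k k' = y ^+ model_carry c k k' * x ^+ i.
  rewrite actX; congr (y ^+ nat_of_ord _ * _).
  by case: c i k k' {zz zX} => [] [] [] []; apply/val_inj.
have zxC (k i : bool) : z ^+ k * x ^+ i = x ^+ i * z ^+ k.
  by apply: commuteX2; rewrite /commute xz.
pose f (a : model c) := y ^+ a.1.1 * x ^+ a.1.2 * z ^+ a.2.
have fM : {in [set: model c] &, {morph f : a b / a * b}}.
  move=> [[j i] k] [[j' i'] k'] _ _.
  transitivity (y ^+ (j + model_act i k * j' + model_carry c k k')%R *
    x ^+ (i (+) i') * z ^+ (k (+) k')); first by [].
  rewrite !yD -xX {}/f [RHS]/=.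
  rewrite -!mulgA [z ^+ k * _]mulgA actZ -!mulgA [z ^+ k * _]mulgA zxC -!mulgA.
  rewrite zX [x ^+ i * (y ^+ _ * _)]mulgA actX mulrA -!mulgA.
  congr (_ * (_ * _)).
  by rewrite [RHS]mulgA xX !mulgA carryX -xX !mulgA.
have fE a : Morphism fM a = y ^+ a.1.1 * x ^+ a.1.2 * z ^+ a.2 by [].
have [Hx Hy Hz] : [/\ x \in H, y \in H & z \in H].
  have := subxx H; rewrite -{1}defH !join_subG !cycle_subG.
  by case/andP=> /andP[].
apply/homgP; exists (Morphism fM); apply/eqP; rewrite eqEsubset.
apply/andP; split.
  apply/subsetP=> _ /morphimP[a _ _ ->].
  by rewrite fE !groupM ?groupX.
rewrite -defH !join_subG !cycle_subG -!andbA.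
apply/and3P; split; apply/morphimP.
- by exists (model_x c); rewrite ?inE // fE !mul1g mulg1.
- by exists (model_y c); rewrite ?inE // fE !mulg1.
by exists (model_z c); rewrite ?inE // fE !mul1g.
Qed.

Lemma G44_exists :
  exists (gT : finGroupType) (G : {group gT}), is_G44 G /\ #|G| = 32.
Proof.
exists (model false), [set: model false]%G; split; first exact: model_isoGrp.
by rewrite cardsT !card_prod card_bool card_ord.
Qed.

Lemma G45_exists :
  exists (gT : finGroupType) (G : {group gT}), is_G45 G /\ #|G| = 32.
Proof.
exists (model true), [set: model true]%G; split; first exact: model_isoGrp.
by rewrite cardsT !card_prod card_bool card_ord.
Qed.

(* Main.v *)
Require Import Defs.
From mathcomp Require Import all_boot all_fingroup.
From mathcomp Require Import all_algebra.
Import GRing.Theory.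
Local Open Scope group_scope.

(** Let [alpha] fix [y] and [z] and send [x] to [x * y ^+ 4]; since [y ^+ 4] is
    central of order two, this defines an automorphism. It agrees on each
    element with conjugation by [1], [y] or [y ^+ 2], hence preserves conjugacy
    classes. An [h] inducing [alpha] would centralise [y], so lie in [<[y]>],
    and centralise [z], so lie in [<[y ^+ 4]>], which is central; but [alpha]
    moves [x]. *)

Definition has_noninner_class_preserving {gT : finGroupType} (G : {group gT}) :=
  exists alpha : {perm gT},
    [/\ alpha \in Aut G, class_preserving G alpha & ~ inner G alpha].

(** Conjugating [alpha] by the isomorphism carries it to [H], so the explicit model suffices. *)
Lemma isog_has_noninner {gT rT : finGroupType} (G : {group gT})
    (H : {group rT}) :
  G \isog H -> has_noninner_class_preserving G ->
  has_noninner_class_preserving H.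
Proof.
case/isogP=> f injf defH [a [AutGa a_class a_noninner]].
have {H defH} -> : H = (f @* G)%G by apply: group_inj.
exists (Aut_isom injf (subxx G) a); split; first exact: Aut_Aut_isom.
  move=> _ /morphimP[g _ Gg ->].
  have /imsetP[h Gh a_g] := a_class g Gg.
  by rewrite Aut_isomE // a_g morphJ // memJ_class // mem_morphim.
case=> _ /morphimP[h _ Gh ->] a_conj; apply: a_noninner; exists h => //.
(* Elements of [Aut G] that agree on [G] are equal as permutations. *)
have AutGh : conj_aut G h \in Aut G by apply: Aut_aut.
apply: (eq_Aut AutGa AutGh) => g Gg; rewrite conj_autE //.
apply: (injmP injf); rewrite ?groupJ ?(Aut_closed AutGa) //.
rewrite -(Aut_isomE injf (subxx G)) // a_conj.
by rewrite conj_autE ?mem_morphim // morphJ.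
Qed.

Section ModelAutomorphism.

Local Open Scope ring_scope.

Variable c : bool.

Definition twist (a : model c) : model c :=
  let: (j, i, k) := a in (j + 4 *+ i, i, k).

Lemma twistK : involutive twist.
Proof.
move=> [[j i] k] /=; congr (_, _, _).
by case: i; rewrite ?addr0 // -addrA -[RHS]addr0; congr (_ + _); apply/val_inj.
Qed.

Lemma twistM : {morph twist : a b / (a * b)%g}.
Proof.
move=> [[j i] k] [[j' i'] k'].
rewrite [LHS]/= [RHS]/=; congr (_, _, _).
rewrite mulrDr -!addrA; congr (_ + _).
rewrite [RHS]addrCA; congr (_ + _).
(* [model_act] takes odd values, so it fixes 4 modulo 8. *)
by case: i i' k k' c => [] [] [] [] []; apply/val_inj.
Qed.

Lemma twist_class (a : model c) : twist a \in (a ^: [set: model c])%g.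
Proof.
(* Conjugating by [y ^+ w] adds [(model_act i k - 1) * w] to the exponent of [y]. For [i = 1] this
   must be 4 modulo 8: the factor is 4 if [k = 0], and -6, that is 2, if [k = 1]. *)
pose w : 'Z_8 := if a.1.2 then if a.2 then 2 else 1 else 0.
apply/imsetP; exists ((w, false, false) : model c); rewrite ?inE //.
rewrite conjgE; apply: (mulgI ((w, false, false) : model c)).
rewrite mulgA mulgV mul1g {}/w.
case: a => [[j i] k] /=; congr (_, _, _); try by rewrite addbF.
rewrite /model_act /model_carry /= !andbF !mul1r !addr0 addrCA; congr (_ + _).
by case: i k => [] []; apply/val_inj.
Qed.

Lemma twist_noninner (h : model c) : ~ forall a, twist a = (a ^ h)%g.
Proof.
move=> twistE.
have {}twistE a : (h * twist a)%g = (a * h)%g by rewrite twistE -conjgC.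
(* The [y]-exponents of the three equations are already incompatible. *)
have coord (a b : model c) : a = b -> val a.1.1 == val b.1.1 by move->.
move: (coord _ _ (twistE (model_x c))) (coord _ _ (twistE (model_y c)))
  (coord _ _ (twistE (model_z c))).
case: h {twistE} => [[[m ltm] i] k].
by move: c i k m ltm => [] [] [] [|[|[|[|[|[|[|[|]]]]]]]].
Qed.

End ModelAutomorphism.

Lemma model_has_noninner (c : bool) :
  has_noninner_class_preserving [set: model c].
Proof.
pose alpha := perm (inv_inj (@twistK c)).
have alphaE a : alpha a = twist c a by rewrite permE.
exists alpha; split.
- rewrite inE; apply/andP; split; first by apply/subsetP=> a; rewrite inE.
  by apply/morphicP=> a b _ _; rewrite !alphaE twistM.
- by move=> a _; rewrite alphaE twist_class.
case=> h _ alpha_conj; apply: (@twist_noninner c h) => a.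
by rewrite -alphaE alpha_conj conj_autE ?inE.
Qed.

(** Each group satisfies the relations of [p], hence is a quotient of the other; finiteness makes
    them isomorphic. *)
Lemma isoGrp_isog {gT rT : finGroupType} (G : {group gT}) (H : {group rT}) p :
  G \isog Grp p -> H \isog Grp p -> G \isog H.
Proof.
by move=> isoG isoH; rewrite isogEhom isoG isoH !isoGrp_hom.
Qed.

Theorem proposition3p1 :
  (forall (gT : finGroupType) (G : {group gT}), is_G44 G ->
     exists alpha : {perm gT},
       [/\ alpha \in Aut G, class_preserving G alpha & ~ inner G alpha]) /\
  (forall (gT : finGroupType) (G : {group gT}), is_G45 G ->
     exists alpha : {perm gT},
       [/\ alpha \in Aut G, class_preserving G alpha & ~ inner G alpha]).
Proof.
split=> gT G isoG.
  apply: isog_has_noninner (model_has_noninner false).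
  (* For [c = false], [y ^+ (4 * c)] computes to 1. *)
  exact: isoGrp_isog (model_isoGrp false) isoG.
apply: isog_has_noninner (model_has_noninner true).
exact: isoGrp_isog (model_isoGrp true) isoG.
Qed.
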